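(* Under the distributed-delay standing assumptions, every solution $\{x_i\}_{i=1}^N$ of the distributed-delay Hegselmann–Krause system satisfies $$d(t)\le\Big(\max_{i,j=1,\dots,N}\ \max_{r,s\in[-\bar\tau,0]}|x_i(r)-x_j(s)|\Big)e^{-\gamma(t-2\bar\tau)}\qquad\text{for all }t\ge0,$$ for a constant $\gamma>0$ depending only on $K$, $\bar\tau$ and $\psi_0:=\min_{|y|,|z|\le M^0}\psi(y,z)$ (in particular independent of $N$ once $M^0$ is fixed), where $M^0:=\max_i\max_{s\in[-\bar\tau,0]}|x_i(s)|$.
   Context: Distributed-delay standing assumptions: $N\ge2$, $d\ge1$, $\bar\tau>0$; $\tau_1,\tau_2:[0,\infty)\to[0,\infty)$ continuous with $0\le\tau_1(t)<\tau_2(t)\le\bar\tau$ for all $t\ge0$; $\alpha:[0,\bar\tau]\to(0,\infty)$ continuous; $h(t):=\int_{\tau_1(t)}^{\tau_2(t)}\alpha(s)\,ds>0$; $\psi:\mathbb{R}^d\times\mathbb{R}^d\to\mathbb{R}$ continuous, bounded and strictly positive, $K:=\|\psi\|_\infty$; initial data $x_i^0:[-\bar\tau,0]\to\mathbb{R}^d$ continuous. The distributed-delay system is $$\frac{d}{dt}x_i(t)=\frac{1}{h(t)}\frac{1}{N-1}\sum_{j\ne i}\int_{t-\tau_2(t)}^{t-\tau_1(t)}\alpha(t-s)\,\psi(x_i(t),x_j(s))\,(x_j(s)-x_i(t))\,ds,\quad t>0,$$ with $x_i=x_i^0$ on $[-\bar\tau,0]$; a solution means continuous $x_i:[-\bar\tau,\infty)\to\mathbb{R}^d$,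 differentiable on $(0,\infty)$, satisfying the system there. $d(t):=\max_{i,j}|x_i(t)-x_j(t)|$. *)

(* Defs.v *)
From HB Require Import structures.
From mathcomp Require Import all_boot all_order all_algebra.
From mathcomp Require Import all_classical all_reals all_analysis.
Set Implicit Arguments. Unset Strict Implicit. Unset Printing Implicit Defensive.
Import Order.TTheory GRing.Theory Num.Theory.
Import numFieldNormedType.Exports.
Local Open Scope classical_set_scope.
Local Open Scope ring_scope.

Section HK.
Variable R : realType.

Definition enorm (d : nat) (v : 'rV[R]_d) : R := Num.sqrt (\sum_(k < d) v 0 k ^+ 2).

Definition integ (a b : R) (f : R -> R) : R :=
  Rintegral (@lebesgue_measure R) `[a, b] f.

Definition hnorm (alpha tau1 tau2 : R -> R) (t : R) : R := integ (tau1 t) (tau2 t) alpha.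

Definition hk_rhs (N d : nat) (alpha tau1 tau2 : R -> R)
  (psi : 'rV[R]_d -> 'rV[R]_d -> R) (x : 'I_N -> R -> 'rV[R]_d) (i : 'I_N) (t : R)
  : 'rV[R]_d :=
  ((hnorm alpha tau1 tau2 t)^-1 * (N%:R - 1)^-1) *:
    \sum_(j < N | j != i)
      \row_(k < d) integ (t - tau2 t) (t - tau1 t)
         (fun s => alpha (t - s) * psi (x i t) (x j s) * (x j s 0 k - x i t 0 k)).

Definition hk_solution (N d : nat) (taubar : R) (alpha tau1 tau2 : R -> R)
  (psi : 'rV[R]_d -> 'rV[R]_d -> R) (x0 x : 'I_N -> R -> 'rV[R]_d) : Prop :=
  (forall i, {within `[- taubar, +oo[, continuous (x i)}) /\
  (forall i s, - taubar <= s <= 0 -> x i s = x0 i s) /\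
  (forall i t, 0 < t -> derivable (x i) t 1) /\
  (forall i t, 0 < t -> 'D_1 (x i) t = hk_rhs alpha tau1 tau2 psi x i t).

Definition diamt (N d : nat) (x : 'I_N -> R -> 'rV[R]_d) (t : R) : R :=
  \big[Num.max/0]_(i < N) \big[Num.max/0]_(j < N) enorm (x i t - x j t).

Definition init_diam (N d : nat) (taubar : R) (x : 'I_N -> R -> 'rV[R]_d) : R :=
  sup [set e | exists i j r s, - taubar <= r <= 0 /\ - taubar <= s <= 0 /\
                   e = enorm (x i r - x j s)].

Definition init_max (N d : nat) (taubar : R) (x : 'I_N -> R -> 'rV[R]_d) : R :=
  sup [set e | exists i s, - taubar <= s <= 0 /\ e = enorm (x i s)].

Definition psi_sup (d : nat) (psi : 'rV[R]_d -> 'rV[R]_d -> R) : R :=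
  sup [set e | exists y z, e = `|psi y z|].

Definition psi_min (d : nat) (psi : 'rV[R]_d -> 'rV[R]_d -> R) (M : R) : R :=
  inf [set e | exists y z, enorm y <= M /\ enorm z <= M /\ e = psi y z].

End HK.

(* Main.v *)
Require Import Defs.
From HB Require Import structures.
From mathcomp Require Import all_boot all_order all_algebra.
From mathcomp Require Import all_classical all_reals all_analysis.
From mathcomp Require Import ring lra.
Import Order.TTheory GRing.Theory Num.Theory.
Import numFieldNormedType.Exports.
Local Open Scope classical_set_scope.
Local Open Scope ring_scope.

(** Project on a direction [v] and let [M], [m] bound the projections on a
    delay window ending at [T]; these bounds persist afterwards, so along the
    trajectory [psi >= psi0].  The gap of agent [i] to [M] satisfies
    [u' >= - K u], hence decays at most exponentially.  At time [T] either the
    average gap to [M] or the average gap to [m] is at least [(M - m) / 2]; say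
    the former.  An agent with gap at least [(M - m) / 4] keeps a fraction of
    it; for any other agent the remaining agents still have average gap at least
    [(M - m) / 2], which feeds its own gap through
    [u' >= - K u + psi0 * average].  So over [3 * taubar] the diameter shrinks by
    a factor [1 - eta], where [eta] does not see [N] because only averages over
    the agents enter.  Windows of length [3 * taubar] give exactly the delay
    [2 * taubar] in the exponent. *)

(** * Euclidean inner product and norm on row vectors *)

Section Dot.
Context {R : realType} {d : nat}.
Implicit Types u v w : 'rV[R]_d.

Definition dot u v : R := \sum_(k < d) u 0 k * v 0 k.

Lemma dotBl u v w : dot (u - v) w = dot u w - dot v w.
Proof. by rewrite /dot -sumrB; apply: eq_bigr => k _; rewrite !mxE mulrBl. Qed.

Lemma dotNr u v : dot u (- v) = - dot u v.
Proof. by rewrite /dot -sumrN; apply: eq_bigr => k _; rewrite mxE mulrN. Qed.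

Lemma enorm_ge0 u : 0 <= enorm u.
Proof. exact: sqrtr_ge0. Qed.

Lemma enorm_sqr u : enorm u ^+ 2 = dot u u.
Proof. by rewrite sqr_sqrtr// sumr_ge0// => k _; exact: sqr_ge0. Qed.

Lemma enormN u : enorm (- u) = enorm u.
Proof.
by rewrite /enorm; congr Num.sqrt; apply: eq_bigr => k _; rewrite mxE sqrrN.
Qed.

Lemma enorm_eq0 u : enorm u = 0 -> u = 0.
Proof.
move=> u0; have /eqP := enorm_sqr u; rewrite u0 expr0n/= eq_sym.
rewrite psumr_eq0 => [/allP uk|k _]; last exact: sqr_ge0.
apply/rowP => k; rewrite mxE; have := uk k (mem_index_enum _).
by rewrite -expr2 sqrf_eq0 => /eqP.
Qed.

(** Cauchy-Schwarz. For nonzero vectors, expand the squared length of [enorm v *: u - enorm u *: v];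
    it equals [2 * (a * b) * (a * b - dot u v)] with [a], [b] the two norms. *)
Lemma dot_enorm u v : dot u v <= enorm u * enorm v.
Proof.
have [u0|u_neq0] := eqVneq (enorm u) 0.
  rewrite u0 mul0r (enorm_eq0 _ u0) /dot big1// => k _.
  by rewrite mxE mul0r.
have [v0|v_neq0] := eqVneq (enorm v) 0.
  rewrite v0 mulr0 (enorm_eq0 _ v0) /dot big1// => k _.
  by rewrite mxE mulr0.
have uv0 : 0 < enorm u * enorm v.
  by rewrite mulr_gt0// lt_def ?u_neq0 ?v_neq0 enorm_ge0.
have : 0 <= \sum_(k < d) (enorm v * u 0 k - enorm u * v 0 k) ^+ 2.
  by apply: sumr_ge0 => k _; exact: sqr_ge0.
have -> : \sum_(k < d) (enorm v * u 0 k - enorm u * v 0 k) ^+ 2 =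
    enorm v ^+ 2 * dot u u + enorm u ^+ 2 * dot v v
    - 2 * (enorm u * enorm v) * dot u v.
  rewrite /dot !mulr_sumr -big_split/= -sumrB.
  by apply: eq_bigr => k _; ring.
rewrite -!enorm_sqr.
set a := enorm u; set b := enorm v; move=> h.
have : 0 <= 2 * (a * b) * (a * b - dot u v).
  by apply: (le_trans h); rewrite le_eqVlt; apply/orP; left; apply/eqP; ring.
by rewrite pmulr_rge0 ?subr_ge0// mulr_gt0.
Qed.

(** The bridge from projections to norms: a vector is projected on itself and one factor [enorm u]
    is cancelled. The later norm estimates on trajectories all pass through this. *)
Lemma enorm_le_dot u c : dot u u <= c * enorm u -> 0 <= c -> enorm u <= c.
Proof.
move=> h c0; have [->//|u0] := eqVneq (enorm u) 0.
have {}u0 : 0 < enorm u by rewrite lt_def u0 enorm_ge0.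
by move: h; rewrite -enorm_sqr expr2 ler_pM2r.
Qed.

Lemma le_enormB u v : enorm (u - v) <= enorm u + enorm v.
Proof.
apply: enorm_le_dot; last by rewrite addr_ge0 ?enorm_ge0.
rewrite dotBl mulrDl lerD ?dot_enorm// -dotNr.
by apply: (le_trans (dot_enorm _ _)); rewrite enormN.
Qed.

Lemma normr_coord_le_enorm u k : `|u 0 k| <= enorm u.
Proof.
rewrite -(@ler_pXn2r _ 2) ?nnegrE ?normr_ge0 ?enorm_ge0//.
rewrite enorm_sqr real_normK ?num_real//.
rewrite /dot (bigD1 k)//= -expr2 lerDl.
by apply: sumr_ge0 => i _; rewrite -expr2 sqr_ge0.
Qed.

Lemma continuous_dot v : continuous (dot^~ v).
Proof.
rewrite /dot; apply: continuous_big => [x|k _ u].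
  exact: add_continuous.
apply: (@continuousM _ _ (fun u : 'rV[R]_d => u 0 k) (cst (v 0 k))).
  exact: coord_continuous.
exact: cst_continuous.
Qed.

Lemma continuous_enorm : continuous (@enorm R d).
Proof.
move=> u.
apply: (@continuous_comp _ _ _ (fun u : 'rV[R]_d => \sum_(k < d) u 0 k ^+ 2)
  (@Num.sqrt R)).
  apply: continuous_big => [x|k _ w]; first exact: add_continuous.
  apply: (@continuous_comp _ _ _ (fun u : 'rV[R]_d => u 0 k)
    (fun x : R => x ^+ 2)).
    exact: coord_continuous.
  exact: exprn_continuous.
exact: sqrt_continuous.
Qed.

(** The ambient norm on row vectors is the maximum of the coordinates, which [enorm] dominates;
    closedness comes from continuity of [enorm]. *)
Lemma compact_enorm_ball (M : R) : compact [set u : 'rV[R]_d | enorm u <= M].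
Proof.
apply: bounded_closed_compact.
  exists M; split=> [|B MB u /= uM]; first exact: num_real.
  rewrite [leLHS]/Num.Def.normr/= mx_normrE; apply: bigmax_le => [|[i k] _ /=].
    exact: le_trans (enorm_ge0 u) (le_trans uM (ltW MB)).
  rewrite (ord1 i); apply: (le_trans (normr_coord_le_enorm u k)).
  exact: (le_trans uM (ltW MB)).
apply: (@closed_comp _ _ (@enorm R d) [set r : R | r <= M]).
  by move=> u _; exact: continuous_enorm.
exact: closed_le.
Qed.

Lemma is_derive_dot (x : R -> 'rV[R]_d) v t : derivable x t 1 ->
  is_derive t (1 : R) (fun s => dot (x s) v) (dot ('D_1 x t) v).
Proof.
move=> dx.
have -> : (fun s => dot (x s) v) = \sum_(k < d) (fun s => x s 0 k * v 0 k).
  by apply/funext => s; rewrite fct_sumE.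
apply: is_derive_sum => k; rewrite derive_mx// mxE.
have dxk : derivable (fun s => x s 0 k) t 1.
  exact: ((derivable_mxP x t 1).1 dx 0 k).
have dxk' : is_derive t (1 : R) (fun s => x s 0 k) ('D_1 (fun s => x s 0 k) t).
  exact: DeriveDef.
have -> : (fun s => x s 0 k * v 0 k) = v 0 k \*: (fun s => x s 0 k).
  by apply/funext => s; rewrite /= mulrC.
by rewrite mulrC; exact: is_deriveZ.
Qed.

End Dot.

(** * Positivity of the minimal interaction strength on a ball *)

Section PsiMin.
Context {R : realType} {d : nat} (psi : 'rV[R]_d -> 'rV[R]_d -> R) (M : R).
Hypothesis psi_gt0 : forall y z, 0 < psi y z.

Lemma psi_min_le y z : enorm y <= M -> enorm z <= M -> psi_min psi M <= psi y z.
Proof.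
move=> yM zM; apply: ge_inf; last by exists y, z.
by exists 0 => _ [u [w [_ [_ ->]]]]; exact/ltW/psi_gt0.
Qed.

Lemma psi_min_gt0 : continuous (fun p : 'rV[R]_d * 'rV[R]_d => psi p.1 p.2) ->
  0 <= M -> 0 < psi_min psi M.
Proof.
move=> cpsi M0; pose B := [set u : 'rV[R]_d | enorm u <= M].
have B0 : B 0.
  rewrite /B/= /enorm big1 ?sqrtr0// => k _.
  by rewrite mxE expr0n.
have BB0 : (B `*` B) !=set0 by exists (0, 0).
have cBB : compact (B `*` B) by apply: compact_setX; exact: compact_enorm_ball.
(* The infimum is bounded below by a value that [psi] attains, so pointwise positivity becomes
   uniform. *)
have [p _ pmin] := compact_EVT_min BB0 cBB (continuous_subspaceT cpsi).
apply: (lt_le_trans (psi_gt0 p.1 p.2)); apply: lb_le_inf.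
  by exists (psi 0 0), 0, 0.
move=> _ [y [z [yM [zM ->]]]].
by apply: (pmin (y, z)); rewrite inE.
Qed.

End PsiMin.

(** * One-variable extrema and a differential inequality *)

Section Calculus.
Context {R : realType}.
Implicit Types f u : R -> R.

Lemma finite_EVT_max {I : finType} (i0 : I) (f : I -> R -> R) (a b : R) :
  a <= b -> (forall i, {within `[a, b], continuous (f i)}) ->
  exists i c, a <= c <= b /\ forall j s, a <= s <= b -> f j s <= f i c.
Proof.
move=> ab cf.
have maxf i : exists c, a <= c <= b /\ forall s, a <= s <= b -> f i s <= f i c.
  have [c cab fmax] := EVT_max ab (cf i); exists c; split=> [|s sab].
    by move: cab; rewrite in_itv.
  by apply: fmax; rewrite in_itv.
have [c cP] := choice maxf.
exists [arg max_(i > i0) f i (c i)]%O.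
case: arg_maxP => // i _ imax; exists (c i); split; first exact: (cP i).1.
by move=> j s sab; apply: (le_trans ((cP j).2 s sab)); exact: imax.
Qed.

(** Only left difference quotients enter, and these are nonnegative. This suits a maximum at the
    right end of an interval, where the derivative need not vanish. *)
Lemma derive_left_max f (a c : R) : a < c -> derivable f c 1 ->
  (forall t, a <= t <= c -> f t <= f c) -> 0 <= 'D_1 f c.
Proof.
move=> ac dfc cmax; rewrite ['D_1 f c]cvg_at_leftE; last exact: dfc.
apply: limr_ge.
  rewrite -(cvg_at_leftE (fun h => h^-1 *: ((f \o shift c) _ - f c)))//.
  apply: cvg_trans dfc; apply: cvg_app.
  move=> A [e egt0 Ae]; exists e => // x xe xgt0; apply: Ae => //.
  exact/ltr0_neq0.
near=> h.
have h0 : h <= 0 by apply: ltW; near: h; exists 1 => /=.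
apply: mulr_le0; first by rewrite invr_le0.
rewrite subr_le0 [_%:A]mulr1; apply: cmax.
rewrite /= gerDr h0 andbT -lerBlDr; near: h.
exists (c - a); first by rewrite /= subr_gt0.
by move=> h; rewrite /= distrC subr0 => /ltr_normlP[]; lra.
Unshelve. all: by end_near. Qed.

(** Apply the mean value theorem to [expR (K * s) * u s]: its derivative at an interior [c] is at
    least [expR (K * c) * q], hence at least [expR (K * a) * q]. Keeping the source term linear in
    [b - a] avoids a division by [K]. *)
Lemma gronwall_lower u (du : R -> R) (K q a b : R) :
  0 <= K -> 0 <= q -> a <= b ->
  {within `[a, b], continuous u} ->
  (forall t, a < t < b -> is_derive t (1 : R) u (du t)) ->
  (forall t, a < t < b -> q - K * u t <= du t) ->
  expR (- (K * (b - a))) * (u a + q * (b - a)) <= u b.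
Proof.
move=> K0 q0; rewrite le_eqVlt => /predU1P[<- _ _ _|ab cu dru leu].
  by rewrite subrr !mulr0 oppr0 expR0 mul1r addr0.
pose w s := expR (K * s) * u s.
pose dw s := expR (K * s) * (K * u s + du s).
have cE : continuous (fun s => expR (K * s)).
  move=> s; apply: (@continuous_comp _ _ _ ( *%R K) (@expR R)).
    exact: mulrl_continuous.
  exact: continuous_expR.
have [c cab wE] : exists2 c, c \in `]a, b[%R & w b - w a = dw c * (b - a).
  apply: MVT => // [s sab|].
    have /dru dus : a < s < b by move: sab; rewrite in_itv.
    have dE : is_derive s (1 : R) (fun s => expR (K * s)) (K * expR (K * s)).
      have dK : is_derive s (1 : R) ( *%R K) K.
        have -> : ( *%R K) = K \*: (@id R) by apply/funext.
        by rewrite -[X in is_derive _ _ _ X]mulr1; exact: is_deriveZ.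
      have := @is_derive1_comp R (@expR R) ( *%R K) s _ _ (is_derive_expR _) dK.
      by rewrite mulrC.
    have := @is_deriveM R _ (fun s => expR (K * s)) u s 1 _ _ dE dus.
    move=> h; apply: (is_derive_eq h).
    by rewrite /dw /GRing.scale/=; ring.
  move=> s; apply: (@continuousM _ (subspace `[a, b]) (fun s => expR (K * s)) u).
    exact: (continuous_subspaceT cE).
  exact: cu.
have /andP[ac cb] : a < c < b by move: cab; rewrite in_itv.
have dwc : expR (K * a) * q <= dw c.
  rewrite /dw; apply: ler_pM; rewrite ?expR_ge0// ?ler_expR.
    by rewrite ler_wpM2l// ltW.
  by have := leu c; rewrite ac cb => /(_ isT); lra.
have wb : expR (K * a) * (u a + q * (b - a)) <= expR (K * b) * u b.
  have -> : expR (K * b) * u b = w a + (w b - w a) by rewrite /w; ring.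
  rewrite wE mulrDr lerD2l mulrA ler_wpM2r// subr_ge0; exact: ltW.
rewrite -(@ler_pM2l _ (expR (K * b))) ?expR_gt0// mulrA -expRD.
by rewrite (_ : K * b + _ = K * a)//; ring.
Qed.

End Calculus.

(** * Continuity relative to a subset *)

Section WithinContinuous.

(** Meant for [alpha (t - s)]: the outer function is continuous only relative to a set, which the
    inner one must not leave. *)
Lemma within_continuous_comp_within {T U V : topologicalType} (A : set T)
    (B : set U) (f : T -> U) (g : U -> V) :
  (forall s, A s -> B (f s)) -> continuous f -> {within B, continuous g} ->
  {within A, continuous (g \o f)}.
Proof.
move=> AB cf /subspace_continuousP cg; apply/subspace_continuousP => s As.
apply: (@cvg_comp _ _ _ f g _ _ _ _ (cg _ (AB _ As))) => S /= BS.
have fBS : nbhs s (f @^-1` [set r | B r -> S r]) := cf s _ BS.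
by apply: (@filterS _ (nbhs s) _ _ _ _ fBS) => r BSr Ar; exact/BSr/AB.
Qed.

Context {R : realType} {T : topologicalType} (A : set T).
Implicit Types f g : T -> R.

Lemma within_continuous_cst (c : R) : {within A, continuous (fun=> c)}.
Proof. by apply: continuous_subspaceT => ?; exact: cvg_cst. Qed.

Lemma within_continuousM f g : {within A, continuous f} ->
  {within A, continuous g} -> {within A, continuous (fun s => f s * g s)}.
Proof.
move=> cf cg s; apply: (@continuousM _ (subspace A) f g); [exact: cf|exact: cg].
Qed.

Lemma within_continuous_sum {I : Type} (r : seq I) (P : pred I)
    (F : I -> T -> R) :
  (forall i, P i -> {within A, continuous (F i)}) ->
  {within A, continuous (fun s => \sum_(i <- r | P i) F i s)}.
Proof.
move=> cF; apply: continuous_big => [x|i Pi]; first exact: add_continuous.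
exact: cF.
Qed.

End WithinContinuous.

(** * Integrals of continuous functions over segments *)

Section Integrals.
Context {R : realType}.
Implicit Types f g : R -> R.

Lemma continuous_integrable f (a b : R) : {within `[a, b], continuous f} ->
  (@lebesgue_measure R).-integrable `[a, b] (EFin \o f).
Proof. by apply: continuous_compact_integrable; exact: segment_compact. Qed.

Lemma integZl f (a b c : R) : {within `[a, b], continuous f} ->
  integ a b (fun s => c * f s) = c * integ a b f.
Proof. by move=> cf; apply: RintegralZl => //; exact: continuous_integrable. Qed.

Lemma le_integ f g (a b : R) : {within `[a, b], continuous f} ->
  {within `[a, b], continuous g} -> (forall s, a <= s <= b -> f s <= g s) ->
  integ a b f <= integ a b g.
Proof.
move=> cf cg fg; apply: le_Rintegral => //; exact: continuous_integrable.
Qed.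

Lemma integ_sum {I : Type} (r : seq I) (P : pred I)
    (F : I -> R -> R) (a b : R) :
  (forall i, P i -> {within `[a, b], continuous (F i)}) ->
  integ a b (fun s => \sum_(i <- r | P i) F i s) =
  \sum_(i <- r | P i) integ a b (F i).
Proof.
move=> cF; elim: r => [|i r IH].
  rewrite big_nil; have -> : (fun s : R => \sum_(i <- [::] | P i) F i s) = fun=> 0.
    by apply/funext => s; rewrite big_nil.
  by rewrite /integ Rintegral_cst//= mul0r.
rewrite big_cons; case: ifP => Pi; last first.
  by rewrite -IH; congr integ; apply/funext => s; rewrite big_cons Pi.
rewrite -IH -RintegralD//; last 2 first.
- exact/continuous_integrable/cF.
- exact/continuous_integrable/within_continuous_sum.
by congr integ; apply/funext => s; rewrite big_cons Pi.
Qed.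

Lemma integ_reflect f (a b t : R) : a <= b -> {within `[a, b], continuous f} ->
  integ (t - b) (t - a) (fun s => f (t - s)) = integ a b f.
Proof.
move=> ab cf; pose F s := t - s : R.
have Fa : F (t - a) = a by rewrite /F; ring.
have Fb : F (t - b) = b by rewrite /F; ring.
have dF s : is_derive s (1 : R) F (-1).
  have -> : -1 = 0 - 1 :> R by rewrite sub0r.
  apply: is_deriveB.
have F'E : derive1 F = cst (-1).
  by apply/funext => s; rewrite derive1E; have [_ ->] := dF s.
have cF : continuous F by move=> s; apply: cvgB; [exact: cvg_cst|exact: cvg_id].
have := @integration_by_substitution_decreasing R F f (t - b) (t - a).
rewrite Fa Fb F'E => subst; rewrite /integ /Rintegral subst//.
- by congr fine; apply: eq_integral => s _; rewrite !fctE opprK mulr1.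
- by rewrite lerD2l lerN2.
- by move=> x y _ _ xy; rewrite ltrD2l ltrN2.
- by move=> s _; exact: cvg_cst.
- exact: is_cvg_cst.
- exact: is_cvg_cst.
- split=> [s _||].
  + by have [] := dF s.
  + exact/cvg_at_right_filter/cF.
  + exact/cvg_at_left_filter/cF.
Qed.

End Integrals.

(** The two entries are the fractions of [M - m] guaranteed in the two cases of [gap_uniform]: an
    agent whose gap is already large, and an agent fed by the others. *)
Definition contraction_rate {R : realType} (K taubar p : R) : R :=
  Num.min (expR (- (K * (3 * taubar))) / 4)
          (p * taubar * expR (- (K * (5 * taubar))) / 2).

Lemma contraction_rate_gt0 {R : realType} (K taubar p : R) :
  0 < taubar -> 0 < p -> 0 < contraction_rate K taubar p.
Proof.
move=> taubar0 p0; rewrite lt_min.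
by rewrite !(divr_gt0, mulr_gt0, expR_gt0).
Qed.

(** * Solutions of the delay system *)

Section Trajectories.
Context {R : realType} {N d : nat} {taubar : R} {tau1 tau2 alpha : R -> R}.
Context {psi : 'rV[R]_d -> 'rV[R]_d -> R} {x0 x : 'I_N -> R -> 'rV[R]_d}.
Hypothesis N_ge2 : (2 <= N)%N.
Hypothesis taubar_gt0 : 0 < taubar.
Hypothesis tauP :
  forall t : R, 0 <= t -> 0 <= tau1 t /\ tau1 t < tau2 t /\ tau2 t <= taubar.
Hypothesis alpha_cont : {within `[0, taubar], continuous alpha}.
Hypothesis alpha_gt0 : forall s : R, 0 <= s <= taubar -> 0 < alpha s.
Hypothesis psi_cont :
  continuous (fun p : 'rV[R]_d * 'rV[R]_d => psi p.1 p.2).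
Hypothesis psi_bounded : exists B : R, forall y z, `|psi y z| <= B.
Hypothesis psi_gt0 : forall y z, 0 < psi y z.
Hypothesis x_sol : hk_solution taubar alpha tau1 tau2 psi x0 x.

Local Notation K := (psi_sup psi).
Local Notation psi0 := (psi_min psi (init_max taubar x)).

Let N1_gt0 : 0 < N%:R - 1 :> R.
Proof. by rewrite subr_gt0 ltr1n. Qed.

Let i0 : 'I_N := Ordinal (leq_trans (isT : (0 < 2)%N) N_ge2).

Lemma psi_le_sup y z : psi y z <= K.
Proof.
apply: (le_trans (ler_norm _)); apply: ub_le_sup; last by exists y, z.
by have [B psiB] := psi_bounded; exists B => _ [u [w ->]].
Qed.

Lemma psi_sup_ge0 : 0 <= K.
Proof. exact: le_trans (ltW (psi_gt0 0 0)) (psi_le_sup 0 0). Qed.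

Lemma x_cont i (a b : R) : - taubar <= a -> {within `[a, b], continuous (x i)}.
Proof.
move=> ta; have [cx _] := x_sol; apply: continuous_subspaceW (cx i).
by move=> s /=; rewrite !in_itv/= andbT => /andP[+ _]; exact: le_trans.
Qed.

Lemma dot_x_cont i v (a b : R) : - taubar <= a ->
  {within `[a, b], continuous (fun s => dot (x i s) v)}.
Proof.
move=> ta s; apply: (@continuous_comp (subspace `[a, b]) _ _ (x i) (dot^~ v)).
  exact: (@x_cont i a b ta s).
exact: continuous_dot.
Qed.

Lemma psi_x_cont y j (a b : R) : - taubar <= a ->
  {within `[a, b], continuous (fun s => psi y (x j s))}.
Proof.
move=> ta s; apply: (@continuous_comp (subspace `[a, b]) _ _ (fun s => (y, x j s))
  (fun p => psi p.1 p.2)); last exact: psi_cont.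
apply: (@cvg_pair _ _ _ (nbhs (s : subspace `[a, b])) (nbhs y) (nbhs (x j s))
  _ _ _ (cst y) (x j)); first exact: cvg_cst.
exact: (@x_cont j a b ta s).
Qed.

Lemma is_derive_dot_x i v (t : R) : 0 < t ->
  is_derive t (1 : R) (fun s => dot (x i s) v)
    (dot (hk_rhs alpha tau1 tau2 psi x i t) v).
Proof.
have [_ [_ [dx Dx]]] := x_sol => t0.
by rewrite -Dx//; apply: is_derive_dot; exact: dx.
Qed.

(** * The normalized kernel and bounds on projected velocities *)

Lemma hnorm_gt0 (t : R) : 0 <= t -> 0 < hnorm alpha tau1 tau2 t.
Proof.
move=> t0; have [t1 [t12 t2]] := tauP _ t0.
have ca : {within `[tau1 t, tau2 t], continuous alpha}.
  apply: continuous_subspaceW alpha_cont => s /=.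
  by rewrite !in_itv/=; lra.
have [c + minc] := EVT_min (ltW t12) ca.
rewrite in_itv/= => cP.
have : integ (tau1 t) (tau2 t) (cst (alpha c)) <= hnorm alpha tau1 tau2 t.
  apply: le_integ => //; first by apply: continuous_subspaceT => ?; exact: cvg_cst.
apply: lt_le_trans; rewrite /integ Rintegral_cst//= lebesgue_measure_itv/= lte_fin.
rewrite t12/=.
by rewrite mulr_gt0 ?subr_gt0// alpha_gt0//; lra.
Qed.

Let kernel_cont (t : R) : 0 <= t ->
  {within `[t - tau2 t, t - tau1 t], continuous (fun s : R => alpha (t - s))}.
Proof.
move=> t0; have [t1 [t12 t2]] := tauP _ t0.
apply: (@continuous_subspaceW _ _ _ `[t - taubar, t]).
  by move=> s /=; rewrite !in_itv/=; lra.
apply: (within_continuous_comp_within _ `[0, taubar]%classic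
  (fun s : R => t - s) alpha) => //.
  by move=> s /=; rewrite !in_itv/=; lra.
by move=> s; apply: cvgB; [exact: cvg_cst|exact: cvg_id].
Qed.

Lemma dot_hk_rhs i v (t : R) : 0 < t ->
  dot (hk_rhs alpha tau1 tau2 psi x i t) v =
  (hnorm alpha tau1 tau2 t)^-1 * (N%:R - 1)^-1 *
  integ (t - tau2 t) (t - tau1 t) (fun s => alpha (t - s) *
    \sum_(j < N | j != i) psi (x i t) (x j s) * (dot (x j s) v - dot (x i t) v)).
Proof.
move=> t0; have [t1 [t12 t2]] := tauP _ (ltW t0).
have ta : - taubar <= t - tau2 t by lra.
have termC j k : {within `[t - tau2 t, t - tau1 t], continuous
    (fun s => alpha (t - s) * psi (x i t) (x j s) * (x j s 0 k - x i t 0 k))}.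
  apply: within_continuousM.
    by apply: within_continuousM; [exact/kernel_cont/ltW|exact: psi_x_cont].
  apply: (@within_continuousB _ _ _ _ (fun s => x j s 0 k)); last first.
    exact: within_continuous_cst.
  move=> s; apply: (@continuous_comp (subspace _) _ _ (x j)
    (fun u : 'rV[R]_d => u 0 k)); first exact: x_cont.
  exact: coord_continuous.
rewrite /hk_rhs /dot.
under eq_bigr => k _ do rewrite mxE summxE -[_ * _ * v 0 k]mulrA.
rewrite -mulr_sumr; congr (_ * _).
under eq_bigr => k _.
  under eq_bigr => j _ do rewrite mxE.
  rewrite mulrC -integ_sum// -integZl; last exact: within_continuous_sum.
  over.
rewrite -integ_sum; last first.
  move=> k _; apply: within_continuousM; first exact: within_continuous_cst.
  exact: within_continuous_sum.
congr integ; apply/funext => s.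
under eq_bigr => k _ do rewrite mulr_sumr.
rewrite exchange_big/= mulr_sumr; apply: eq_bigr => j _.
by rewrite -sumrB !mulr_sumr; apply: eq_bigr => k _; ring.
Qed.

(** After reflection, the kernel [alpha (t - s)] has total mass [hnorm alpha tau1 tau2 t], so the
    velocity is a weighted mean over delayed times, and a bound valid at each such time passes to
    it. *)
Lemma velocity_le i v (t : R) (C : R) : 0 < t ->
  (forall s : R, t - tau2 t <= s <= t - tau1 t ->
    \sum_(j < N | j != i) psi (x i t) (x j s) * (dot (x j s) v - dot (x i t) v)
      <= (N%:R - 1) * C) ->
  dot (hk_rhs alpha tau1 tau2 psi x i t) v <= C.
Proof.
move=> t0 leC; have [t1 [t12 t2]] := tauP _ (ltW t0).
have ta : - taubar <= t - tau2 t by lra.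
have h0 := hnorm_gt0 _ (ltW t0).
have hE : integ (t - tau2 t) (t - tau1 t) (fun s : R => alpha (t - s)) =
    hnorm alpha tau1 tau2 t.
  apply: integ_reflect; first exact: ltW.
  apply: continuous_subspaceW alpha_cont => s /=.
  by rewrite !in_itv/=; lra.
rewrite dot_hk_rhs// -invfM mulrC ler_pdivrMr ?mulr_gt0//.
have -> : C * (hnorm alpha tau1 tau2 t * (N%:R - 1)) =
  integ (t - tau2 t) (t - tau1 t) (fun s => ((N%:R - 1) * C) * alpha (t - s)).
  by rewrite integZl ?hE; [ring|exact/kernel_cont/ltW].
apply: le_integ.
- apply: within_continuousM; first exact/kernel_cont/ltW.
  apply: within_continuous_sum => j _; apply: within_continuousM.
    exact: psi_x_cont.
  apply: (@within_continuousB _ _ _ _ (fun s => dot (x j s) v)).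
    exact: dot_x_cont.
  exact: within_continuous_cst.
- apply: within_continuousM; first exact: within_continuous_cst.
  exact/kernel_cont/ltW.
- move=> s sP; rewrite mulrC ler_pM2r ?leC//.
  by apply: alpha_gt0; lra.
Qed.

(** * Maximum principle for projections, and bounds by the initial data *)

Lemma dot_x_le_max v (T M : R) : 0 <= T ->
  (forall i (s : R), T - taubar <= s <= T -> dot (x i s) v <= M) ->
  forall i (t : R), T - taubar <= t -> dot (x i t) v <= M.
Proof.
move=> T0 leM i t tT.
have [tleT|Tltt] := leP t T; first by apply: leM; rewrite tT.
apply/ler_addgt0Pr => e e0.
have taubarT : - taubar <= T - taubar by lra.
(* The denominator is the length of [[T - taubar, t]], so tilting by [eps * s] costs at most [e]
   over that interval. *)
pose eps := e / (t - T + taubar).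
have tb0 := taubar_gt0.
have den0 : 0 < t - T + taubar by lra.
have eps0 : 0 < eps by rewrite divr_gt0.
(* A maximum of [g] at a time [s0 > T] is impossible: there no earlier opinion
   lies above that of the maximizing agent, so its projection does not increase,
   while maximality of [g] from the left forces slope at least [eps]. *)
pose g j s := dot (x j s) v - eps * s.
have gc j : {within `[T - taubar, t], continuous (g j)}.
  apply: (@within_continuousB _ _ _ _ (fun s => dot (x j s) v)).
    exact: dot_x_cont.
  apply: within_continuousM; first exact: within_continuous_cst.
  by apply: continuous_subspaceT => ?; exact: cvg_id.
have [m [s0 [s0P gm]]] := finite_EVT_max i0 g _ _ tT gc.
have [s0T|Ts0] := leP s0 T.
  have : dot (x m s0) v <= M by apply: leM; lra.
  have : g i t <= g m s0 by apply: gm; lra.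
  rewrite /g.
  have : eps * (t - s0) <= e.
    rewrite /eps -mulrA ger_pMr// mulrC ler_pdivrMr//; lra.
  lra.
have s00 : 0 < s0 by lra.
have : dot (hk_rhs alpha tau1 tau2 psi x m s0) v <= 0.
  apply: velocity_le => // s sP; rewrite mulr0; apply: sumr_le0 => j _.
  have [t1 [t12 t2]] := tauP _ (ltW s00).
  rewrite pmulr_rle0 ?psi_gt0//.
  have : g j s <= g m s0 by apply: gm; lra.
  have : eps * s <= eps * s0 by rewrite ler_pM2l//; lra.
  rewrite /g; lra.
have [dg1 dgE] : is_derive s0 (1 : R) (g m)
    (dot (hk_rhs alpha tau1 tau2 psi x m s0) v - eps).
  have -> : g m = (fun s => dot (x m s) v) - eps \*: (@id R) by apply/funext.
  have deps : is_derive s0 (1 : R) (eps \*: (@id R)) eps.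
    by rewrite -[X in is_derive _ _ _ X]mulr1; exact: is_deriveZ.
  apply: is_deriveB.
  exact: is_derive_dot_x.
have : 0 <= 'D_1 (g m) s0.
  apply: (@derive_left_max _ _ (T - taubar)) => //; first by lra.
  by move=> s sP; have := gm m s; apply; lra.
rewrite dgE; lra.
Qed.

(** Needed because [sup] is an upper bound only for sets that are bounded above; it makes [init_max]
    and [init_diam] meaningful. *)
Lemma x_enorm_bounded :
  exists B : R, forall i (s : R), - taubar <= s <= 0 -> enorm (x i s) <= B.
Proof.
have tb0 : - taubar <= 0 by rewrite oppr_le0 ltW.
have [|i [c [_ cmax]]] := finite_EVT_max i0 (fun i s => enorm (x i s)) _ _ tb0.
  move=> i s; apply: (@continuous_comp (subspace _) _ _ (x i) (@enorm R d)).
    exact: x_cont.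
  exact: continuous_enorm.
by exists (enorm (x i c)); exact: cmax.
Qed.

Lemma enorm_le_init_max i (s : R) : - taubar <= s <= 0 ->
  enorm (x i s) <= init_max taubar x.
Proof.
move=> sP; apply: ub_le_sup; last by exists i, s.
by have [B xB] := x_enorm_bounded; exists B => _ [j [r [rP ->]]]; exact: xB.
Qed.

Lemma enorm_le_init_diam i j (r s : R) : - taubar <= r <= 0 ->
  - taubar <= s <= 0 -> enorm (x i r - x j s) <= init_diam taubar x.
Proof.
move=> rP sP; apply: ub_le_sup; last by exists i, j, r, s.
have [B xB] := x_enorm_bounded; exists (B + B).
move=> _ [k [l [a [b [aP [bP ->]]]]]].
by apply: (le_trans (le_enormB _ _)); apply: lerD; exact: xB.
Qed.

Lemma init_max_ge0 : 0 <= init_max taubar x.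
Proof.
apply: le_trans (enorm_ge0 (x i0 0)) (enorm_le_init_max i0 0 _).
by rewrite lexx andbT oppr_le0 ltW.
Qed.

Lemma enorm_x_le_init_max i (t : R) : - taubar <= t ->
  enorm (x i t) <= init_max taubar x.
Proof.
move=> tt; apply: enorm_le_dot; last exact: init_max_ge0.
(* The direction is [x i t] itself: by Cauchy-Schwarz the initial projections on it are at most
   [init_max taubar x * enorm (x i t)]. *)
apply: (dot_x_le_max _ 0); rewrite ?sub0r// => j s sP.
apply: (le_trans (dot_enorm _ _)); rewrite ler_wpM2r ?enorm_ge0//.
exact: enorm_le_init_max.
Qed.

Lemma psi0_gt0 : 0 < psi0.
Proof. by apply: psi_min_gt0 => //; exact: init_max_ge0. Qed.

Lemma psi0_le i j (t s : R) : - taubar <= t -> - taubar <= s ->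
  psi0 <= psi (x i t) (x j s).
Proof. by move=> tt ts; apply: psi_min_le => //; exact: enorm_x_le_init_max. Qed.

(** * Lower bounds for the gap to an upper barrier *)

Lemma gap_growth v (T M q a b : R) i : 0 <= T ->
  (forall j (s : R), T - taubar <= s <= T -> dot (x j s) v <= M) ->
  0 <= q -> T <= a -> a <= b ->
  (forall t s : R, a < t < b -> t - tau2 t <= s <= t - tau1 t ->
    (N%:R - 1) * q <= psi0 * \sum_(j < N | j != i) (M - dot (x j s) v)) ->
  expR (- (K * (b - a))) * (M - dot (x i a) v + q * (b - a)) <=
  M - dot (x i b) v.
Proof.
move=> T0 leM q0 Ta ab qle.
have tb0 := taubar_gt0.
have leM' := dot_x_le_max v T M T0 leM.
apply: (@gronwall_lower _ (fun t => M - dot (x i t) v)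
  (fun t => - dot (hk_rhs alpha tau1 tau2 psi x i t) v)) => //.
- exact: psi_sup_ge0.
- apply: (@within_continuousB _ _ _ _ (cst M)); first exact: within_continuous_cst.
  by apply: dot_x_cont; lra.
- move=> t tP; have t0 : 0 < t by lra.
  rewrite -[X in is_derive _ _ _ X]sub0r; apply: (@is_deriveB _ _ _ (cst M)).
  exact: is_derive_dot_x.
- move=> t tP; have t0 : 0 < t by lra.
  have [t1 [t12 t2]] := tauP _ (ltW t0).
  suff : dot (hk_rhs alpha tau1 tau2 psi x i t) v <=
    K * (M - dot (x i t) v) - q by lra.
  apply: velocity_le => // s sP.
  have yit : 0 <= M - dot (x i t) v by rewrite subr_ge0 leM'//; lra.
  (* Inserting [M] splits the velocity into a loss governed by the agent's own gap, where [psi <= K]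
     applies, and a gain from the gaps of the others, where [psi >= psi0] applies. Both bounds need
     the gaps to be nonnegative. *)
  have -> : \sum_(j < N | j != i) psi (x i t) (x j s) *
      (dot (x j s) v - dot (x i t) v)
    = \sum_(j < N | j != i) psi (x i t) (x j s) * (M - dot (x i t) v)
    - \sum_(j < N | j != i) psi (x i t) (x j s) * (M - dot (x j s) v).
    by rewrite -sumrB; apply: eq_bigr => j _; ring.
  rewrite mulrBr; apply: lerB.
    have -> : (N%:R - 1) * (K * (M - dot (x i t) v)) =
        \sum_(j < N | j != i) K * (M - dot (x i t) v).
      rewrite sumr_const cardC1 card_ord -[RHS]mulr_natl; congr (_ * _).
      by rewrite -subn1 natrB// (ltnW N_ge2).
    by apply: ler_sum => j _; rewrite ler_wpM2r// psi_le_sup.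
  apply: (le_trans (qle t s tP sP)); rewrite mulr_sumr; apply: ler_sum => j _.
  rewrite ler_wpM2r ?psi0_le//; [|lra|lra].
  by rewrite subr_ge0 leM'//; lra.
Qed.

Lemma gap_decay v (T M t : R) i : 0 <= T ->
  (forall j (s : R), T - taubar <= s <= T -> dot (x j s) v <= M) -> T <= t ->
  expR (- (K * (t - T))) * (M - dot (x i T) v) <= M - dot (x i t) v.
Proof.
move=> T0 leM Tt; have tb0 := taubar_gt0.
have := gap_growth v T M 0 T t i T0 leM (lexx 0) (lexx T) Tt.
rewrite mul0r addr0; apply => r s rP sP; rewrite mulr0.
rewrite mulr_ge0 ?(ltW psi0_gt0)// sumr_ge0// => j _.
have r0 : 0 <= r by lra.
have [_ [_ r2]] := tauP _ r0.
by rewrite subr_ge0 (dot_x_le_max v T M)//; lra.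
Qed.

Local Notation eta := (contraction_rate K taubar psi0).

Lemma eta_le1 : eta <= 1.
Proof.
rewrite /contraction_rate ge_min; apply/orP; left.
have : expR (- (K * (3 * taubar))) <= 1.
  rewrite -[leRHS]expR0 ler_expR oppr_le0 mulr_ge0 ?psi_sup_ge0//.
  by have := taubar_gt0; lra.
lra.
Qed.

Lemma gap_uniform v (T M D t : R) i : 0 <= T ->
  (forall j (s : R), T - taubar <= s <= T -> dot (x j s) v <= M) ->
  0 <= D -> N%:R * (D / 2) <= \sum_(j < N) (M - dot (x j T) v) ->
  T + 2 * taubar <= t <= T + 3 * taubar ->
  eta * D <= M - dot (x i t) v.
Proof.
move=> T0 leM D0 sumD tP; have tb0 := taubar_gt0.
have leM' := dot_x_le_max v T M T0 leM.
set E3 := expR (- (K * (3 * taubar))).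
have E30 : 0 < E3 by exact: expR_gt0.
have decay j (s : R) : T <= s <= T + 3 * taubar ->
    E3 * (M - dot (x j T) v) <= M - dot (x j s) v.
  move=> sP; apply: le_trans (gap_decay v T M s j T0 leM _); last by lra.
  rewrite ler_wpM2r ?ler_expR ?lerN2//; first by rewrite subr_ge0 leM'//; lra.
  by rewrite ler_wpM2l ?psi_sup_ge0//; lra.
have [uiD|uiD] := leP (D / 4) (M - dot (x i T) v).
  apply: le_trans (decay i t _); last by lra.
  apply: (@le_trans _ _ (E3 * (D / 4))); last by rewrite ler_pM2l.
  rewrite (_ : E3 * (D / 4) = E3 / 4 * D); last by ring.
  by rewrite ler_wpM2r// ge_min lexx.
(* The removed gap is below [D / 4], hence below its share [D / 2], so the average over the other
   agents stays at least [D / 2]. *)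
have sumi : (N%:R - 1) * (D / 2) <= \sum_(j < N | j != i) (M - dot (x j T) v).
  by move: sumD; rewrite (bigD1 i)//=; lra.
have q0 : 0 <= psi0 * E3 * (D / 2).
  by rewrite !mulr_ge0 ?(ltW psi0_gt0) ?(ltW E30)//; lra.
have Tt : T + taubar <= t by lra.
have TT : T <= T + taubar by lra.
(* Growth is started at [T + taubar] so that all delayed times are at least [T], where [decay]
   bounds the gaps of the other agents from below. *)
have := gap_growth v T M (psi0 * E3 * (D / 2)) (T + taubar) t i T0 leM q0 TT Tt.
have qP (r s : R) : T + taubar < r < t -> r - tau2 r <= s <= r - tau1 r ->
    (N%:R - 1) * (psi0 * E3 * (D / 2)) <=
    psi0 * (\sum_(j < N | j != i) (M - dot (x j s) v)).
  move=> rP sP; have r0 : 0 <= r by lra.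
  have [r1 [r12 r2]] := tauP _ r0.
  rewrite -mulrA mulrCA ler_pM2l ?psi0_gt0// mulrCA.
  apply: (@le_trans _ _ (E3 * \sum_(j < N | j != i) (M - dot (x j T) v))).
    by rewrite ler_pM2l.
  by rewrite mulr_sumr; apply: ler_sum => j _; apply: decay; lra.
move=> /(_ qP); apply: le_trans.
(* The elapsed time [t - (T + taubar)] lies between [taubar] and [2 * taubar]: the upper end bounds
   the exponential, the lower end the linear gain. With [E3] the exponent totals [5 * taubar]. *)
apply: (@le_trans _ _ (expR (- (K * (2 * taubar))) *
  (psi0 * E3 * (D / 2) * taubar))).
  have -> : expR (- (K * (2 * taubar))) * (psi0 * E3 * (D / 2) * taubar) =
      psi0 * taubar * expR (- (K * (5 * taubar))) / 2 * D.
    have -> : - (K * (5 * taubar)) = - (K * (2 * taubar)) + - (K * (3 * taubar)).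
      by ring.
    by rewrite expRD -/E3; field.
  by rewrite ler_wpM2r// ge_min lexx orbT.
apply: ler_pM; [exact: expR_ge0|by rewrite mulr_ge0// ltW| |].
  by rewrite ler_expR lerN2 ler_wpM2l ?psi_sup_ge0//; lra.
rewrite -[leLHS]add0r lerD//; first by rewrite subr_ge0 leM'//; lra.
by rewrite ler_wpM2l//; lra.
Qed.

(** * Diameters over a whole delay window, compared across different times *)

Definition spread_le (T D : R) := forall i j (r s : R),
  T - taubar <= r <= T -> T - taubar <= s <= T -> enorm (x i r - x j s) <= D.

Lemma spread_ge0 (T D : R) : spread_le T D -> 0 <= D.
Proof.
move=> TD; apply: le_trans (enorm_ge0 _) (TD i0 i0 T T _ _).
all: by rewrite lexx andbT gerBl ltW.
Qed.

(** [M] and [m] are attained extremes over the window, so Cauchy-Schwarz controls [M - m]. The lower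
    bound is phrased with [- v] so that results on upper barriers serve both sides. *)
Lemma spread_dot (T D : R) v : 0 <= T -> spread_le T D -> exists M m : R,
  [/\ m <= M, M - m <= D * enorm v,
     forall j (s : R), T - taubar <= s <= T -> dot (x j s) v <= M &
     forall j (s : R), T - taubar <= s <= T -> dot (x j s) (- v) <= - m].
Proof.
move=> T0 TD; have tb0 := taubar_gt0.
have Tt : T - taubar <= T by lra.
have Ttb : - taubar <= T - taubar by lra.
have [i [r [rP rmax]]] :=
  finite_EVT_max i0 (fun i s => dot (x i s) v) _ _ Tt
    (fun i => dot_x_cont i v _ _ Ttb).
have [j [s [sP smax]]] :=
  finite_EVT_max i0 (fun i s => dot (x i s) (- v)) _ _ Tt
    (fun i => dot_x_cont i (- v) _ _ Ttb).
exists (dot (x i r) v), (dot (x j s) v); split=> //.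
- exact: rmax.
- rewrite -dotBl; apply: (le_trans (dot_enorm _ _)).
  by rewrite ler_wpM2r ?enorm_ge0// TD.
- by move=> k a aP; rewrite -dotNr; exact: smax.
Qed.

Lemma spread_le_after (T D : R) : 0 <= T -> spread_le T D ->
  forall i j (r s : R), T - taubar <= r -> T - taubar <= s ->
  enorm (x i r - x j s) <= D.
Proof.
move=> T0 TD i j r s rT sT; apply: enorm_le_dot; last exact: spread_ge0 TD.
have [M [m [mM Mm leM lem]]] := spread_dot T D (x i r - x j s) T0 TD.
rewrite dotBl; apply: le_trans Mm.
have := dot_x_le_max _ T M T0 leM i r rT.
have := dot_x_le_max _ T (- m) T0 lem j s sT.
by rewrite dotNr; lra.
Qed.

(** Project on the difference to be bounded. One of its endpoints moves away from its barrier by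
    [eta * (M - m)], while persistence of the other barrier suffices for the second endpoint. *)
Lemma spread_contraction (T D : R) : 0 <= T -> spread_le T D ->
  spread_le (T + 3 * taubar) ((1 - eta) * D).
Proof.
move=> T0 TD i j r s rP sP; have tb0 := taubar_gt0.
have eta1 : 0 <= 1 - eta by rewrite subr_ge0 eta_le1.
apply: enorm_le_dot; last by rewrite mulr_ge0// (spread_ge0 T).
set v := x i r - x j s.
have [M [m [mM Mm leM lem]]] := spread_dot T D v T0 TD.
rewrite -mulrA; apply: (@le_trans _ _ ((1 - eta) * (M - m))); last first.
  by rewrite ler_wpM2l.
rewrite {1}/v dotBl.
have rT : T - taubar <= r by lra.
have sT : T - taubar <= s by lra.
have yM := dot_x_le_max _ T M T0 leM i r rT.
have ym := dot_x_le_max _ T (- m) T0 lem j s sT.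
have Mm0 : 0 <= M - m by lra.
(* Each agent's two gaps add up to [M - m], so at least one of the two sums reaches half of the
   total. *)
have sumE : \sum_(k < N) (M - dot (x k T) v)
    + \sum_(k < N) (- m - dot (x k T) (- v)) = N%:R * (M - m).
  rewrite -big_split/=; under eq_bigr => k _ do
    rewrite dotNr opprK addrACA addNr addr0.
  by rewrite sumr_const card_ord mulr_natl.
have [halfM|halfM] := leP (N%:R * ((M - m) / 2))
  (\sum_(k < N) (M - dot (x k T) v)).
  have := gap_uniform v T M (M - m) r i T0 leM Mm0 halfM.
  by move: ym; rewrite dotNr => ym /(_ _); lra.
have halfm : N%:R * ((M - m) / 2) <= \sum_(k < N) (- m - dot (x k T) (- v)).
  by lra.
have := gap_uniform (- v) T (- m) (M - m) s j T0 lem Mm0 halfm.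
by rewrite dotNr => /(_ _); lra.
Qed.

Lemma spread_iter n : spread_le (3 * taubar * n%:R)
  (init_diam taubar x * expR (- eta * n%:R)).
Proof.
elim: n => [|n IH].
  rewrite !mulr0 expR0 mulr1 => i j r s; rewrite sub0r; exact: enorm_le_init_diam.
have T0 : 0 <= 3 * taubar * n%:R by rewrite !mulr_ge0// ltW.
have nE : 3 * taubar * n.+1%:R = 3 * taubar * n%:R + 3 * taubar.
  by rewrite -natr1; ring.
rewrite nE => i j r s rP sP.
apply: (le_trans (spread_contraction _ _ T0 IH i j r s rP sP)).
rewrite mulrCA ler_wpM2l//.
  by apply: (@spread_ge0 0) => k l a b; rewrite sub0r; exact: enorm_le_init_diam.
(* What remains is [1 - eta <= expR (- eta)]. *)
rewrite -natr1 mulrDr mulr1 expRD mulrC ler_wpM2l ?expR_ge0//.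
exact: expR_ge1Dx.
Qed.

Lemma diamt_decay (t : R) : 0 <= t ->
  diamt x t <= init_diam taubar x *
    expR (- (eta / (3 * taubar)) * (t - 2 * taubar)).
Proof.
move=> t0; have tb0 := taubar_gt0.
(* The largest [n] whose window, starting at [3 * taubar * n - taubar], has begun by time [t].
   Maximality gives [t - 2 * taubar < 3 * taubar * n], the source of the shift in the exponent. *)
pose n := Num.truncn ((t + taubar) / (3 * taubar)).
have tb3 : 0 < 3 * taubar by lra.
have ttb0 : 0 <= (t + taubar) / (3 * taubar) by rewrite divr_ge0//; lra.
have /andP[nle nlt] := truncn_itv ttb0; rewrite -/n in nle nlt.
rewrite ler_pdivlMr// in nle; rewrite ltr_pdivrMr// -natr1 in nlt.
have diam0 : 0 <= init_diam taubar x.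
  by apply: (@spread_ge0 0) => k l a b; rewrite sub0r; exact: enorm_le_init_diam.
have eta0 : 0 < eta by apply: contraction_rate_gt0 => //; exact: psi0_gt0.
apply: (@le_trans _ _ (init_diam taubar x * expR (- eta * n%:R))).
  apply: bigmax_le => [|i _]; first by rewrite mulr_ge0// expR_ge0.
  apply: bigmax_le => [|j _]; first by rewrite mulr_ge0// expR_ge0.
  have T0 : 0 <= 3 * taubar * n%:R by rewrite mulr_ge0// ltW.
  by apply: (spread_le_after _ _ T0 (spread_iter n)); lra.
rewrite ler_wpM2l// ler_expR !mulNr lerN2 -mulrA ler_pM2l// mulrC.
by rewrite ler_pdivrMr//; lra.
Qed.

End Trajectories.

Theorem theorem5p2 (R : realType) :
  exists Gamma : R -> R -> R -> R,
    (forall K taubar psi0, 0 < Gamma K taubar psi0) /\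
    forall (N d : nat) (taubar : R) (tau1 tau2 alpha : R -> R)
           (psi : 'rV[R]_d -> 'rV[R]_d -> R) (x0 x : 'I_N -> R -> 'rV[R]_d),
      (2 <= N)%N -> (1 <= d)%N -> 0 < taubar ->
      {within `[0, +oo[, continuous tau1} ->
      {within `[0, +oo[, continuous tau2} ->
      (forall t, 0 <= t -> 0 <= tau1 t /\ tau1 t < tau2 t /\ tau2 t <= taubar) ->
      {within `[0, taubar], continuous alpha} ->
      (forall s, 0 <= s <= taubar -> 0 < alpha s) ->
      continuous (fun p : 'rV[R]_d * 'rV[R]_d => psi p.1 p.2) ->
      (exists B, forall y z, `|psi y z| <= B) ->
      (forall y z, 0 < psi y z) ->
      (forall i, {within `[- taubar, 0], continuous (x0 i)}) ->
      hk_solution taubar alpha tau1 tau2 psi x0 x ->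
      forall t, 0 <= t ->
        diamt x t <= init_diam taubar x *
          expR (- Gamma (psi_sup psi) taubar (psi_min psi (init_max taubar x))
                * (t - 2 * taubar)).
Proof.
(* The rate must be positive for every real triple, so it takes the arbitrary value [1] where
   [taubar] or [psi0] is not positive. It is chosen before [N] and [d], hence uniform in both. *)
exists (fun K taubar psi0 => if (0 < taubar) && (0 < psi0) then
  contraction_rate K taubar psi0 / (3 * taubar) else 1); split.
  move=> K taubar psi0; case: ifP => // /andP[taubar0 psi00].
  by rewrite divr_gt0 ?mulr_gt0 ?contraction_rate_gt0.
move=> N d taubar tau1 tau2 alpha psi x0 x N2 _ taubar0 _ _ tauP ca alpha0 cpsi.
move=> psiB psi_gt0 _ x_sol t t0.
have psi00 : 0 < psi_min psi (init_max taubar x) by exact: psi0_gt0 x_sol.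
rewrite taubar0 psi00/=.
exact: (diamt_decay N2 taubar0 tauP ca alpha0 cpsi psiB psi_gt0 x_sol).
Qed.
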